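(* Given any permutation $\delta=(\delta_1,\dots,\delta_n)$ of $[n]$, it holds for every $j\in[n]$ that $$\eta^{\delta}_{\delta_j}\ \ge\ \rho_{\delta_j}=f(a(\delta(j)))-f(a(\delta(j-1))).$$
   Context: For a non-negative integer $m$, $[m]=\{1,\dots,m\}$ with $[0]=\varnothing$. Let $n,t$ be positive integers, $f:\mathbb{R}\to\mathbb{R}$ a concave function with $f(0)=0$, $a\in\mathbb{R}^n$ with non-negative entries, and $\{N_k\}_{k\in[t]}$ a partition of $[n]$ into consecutive blocks: with $i_0:=0$ and $i_k:=\sum_{j=1}^k|N_j|$, $N_k=\{i_{k-1}+1,\dots,i_k\}$. Within each block the entries of $a$ are ascending: $a_{i_{k-1}+1}\le\cdots\le a_{i_k}$ for all $k\in[t]$. For $S\subseteq[n]$, $a(S):=\sum_{i\in S}a_i$. For a permutation $\delta$ of $[n]$, let $\delta(j):=\{\delta_1,\dots,\delta_j\}$ and $\delta(0)=\varnothing$. The lifting coefficients are defined recursively for $j=1,\dots,n$ by $$\eta^{\delta}_{\delta_j}:=\min_{S}\Big\{ f(a(S))-\sum_{i\in S\setminus\{\delta_j\}}\eta^{\delta}_i \;:\; S\subseteq\delta(j),\ |S\cap N_k|\le 1\ \ \forall k\in[t],\ \delta_j\in S\Big\}.$$ The numbers $\rho_{\delta_j}:=f(a(\delta(j)))-f(a(\delta(j-1)))$ are the coefficients of the classic extended polymatroid inequality $w\ge\sum_{j=1}^n\rho_{\delta_j}x_{\delta_j}$. *)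

(* Defs.v *)
From mathcomp Require Import all_boot all_order perm ssralg ssrnum.
From mathcomp Require Import interval_inference reals convex.

Set Implicit Arguments.
Unset Strict Implicit.
Unset Printing Implicit Defensive.

Import Order.TTheory GRing.Theory Num.Theory.
Local Open Scope ring_scope.
Local Open Scope convex_scope.

(* Indices are 0-based: [n] is 'I_n and the position j in [n] of a permutation
   is an element of 'I_n. *)

Definition concave_function (R : realType) (f : R -> R) : Prop :=
  forall (p : {i01 R}) (x y : R^o),
    (f x : R^o) <| p |> (f y : R^o) <= f (x <| p |> y).

(* Sum of the cardinals of the first k blocks, written i_k in the usual
   1-based notation: block number k then consists of the 0-based indices
   i with i_k <= i < i_(k+1). *)
Definition block_start (n t : nat) (N : 'I_t -> {set 'I_n}) (k : nat) : nat :=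
  (\sum_(j < t | (j < k)%N) #|N j|)%N.

(* As mathcomp's partition excludes empty blocks, the second condition makes
   the family N injective. *)
Definition consecutive_partition (n t : nat) (N : 'I_t -> {set 'I_n}) : Prop :=
  partition [set N k | k : 'I_t] [set: 'I_n] /\
  forall k : 'I_t,
    N k = [set i : 'I_n | (block_start N k <= i < block_start N k.+1)%N].

Definition ascending_in_blocks (R : realType) (n t : nat)
    (N : 'I_t -> {set 'I_n}) (a : 'I_n -> R) : Prop :=
  forall (k : 'I_t) (i1 i2 : 'I_n),
    i1 \in N k -> i2 \in N k -> (i1 <= i2)%N -> a i1 <= a i2.

Definition weight (R : realType) (n : nat) (a : 'I_n -> R) (S : {set 'I_n}) : R :=
  \sum_(i in S) a i.

(* The first j values of delta. For a 0-based position j, perm_prefix delta j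
   stops just before delta j and perm_prefix delta j.+1 ends with it. *)
Definition perm_prefix (n : nat) (delta : 'S_n) (j : nat) : {set 'I_n} :=
  [set delta i | i : 'I_n & (i < j)%N].

Section Lifting.
Variables (R : realType) (n t : nat) (f : R -> R) (a : 'I_n -> R).
Variables (N : 'I_t -> {set 'I_n}) (delta : 'S_n).

Definition lift_feasible (j : 'I_n) (S : {set 'I_n}) : bool :=
  [&& S \subset perm_prefix delta j.+1,
      [forall k : 'I_t, (#|S :&: N k| <= 1)%N] & delta j \in S].

Definition lift_value (eta : 'I_n -> R) (j : 'I_n) (S : {set 'I_n}) : R :=
  f (weight a S) - \sum_(i in S :\ delta j) eta i.

(* The minimum is the value at a minimiser; the singleton of delta j is always
   feasible (see lift_feasible1), as arg min requires. *)
Definition lift_min (eta : 'I_n -> R) (j : 'I_n) : R :=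
  lift_value eta j
    [arg min_(S < [set delta j] | lift_feasible j S) lift_value eta j S]%O.

Definition lift_step (eta : 'I_n -> R) (j : 'I_n) : 'I_n -> R :=
  fun i => if i == delta j then lift_min eta j else eta i.

(* enum 'I_n lists the positions in increasing order. The initial value is
   irrelevant: the step at position j reads only the coefficients of
   perm_prefix delta j. *)
Definition lifting_coeff : 'I_n -> R :=
  foldl lift_step (fun=> 0) (enum 'I_n).

Lemma lift_feasible1 (j : 'I_n) : lift_feasible j [set delta j].
Proof.
apply/and3P; split; last by rewrite set11.
  by rewrite sub1set; apply/imsetP; exists j; rewrite ?inE.
apply/forallP => k; apply: leq_trans (subset_leq_card (subsetIl _ _)) _.
by rewrite cards1.
Qed.

Lemma lift_minP (eta : 'I_n -> R) (j : 'I_n) :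
  (exists2 S, lift_feasible j S & lift_min eta j = lift_value eta j S) /\
  (forall S, lift_feasible j S -> lift_min eta j <= lift_value eta j S).
Proof.
rewrite /lift_min.
by case: arg_minP => [|S fS minS]; [exact: lift_feasible1 | split; [exists S|]].
Qed.

Lemma eq_lift_min (eta eta' : 'I_n -> R) (j : 'I_n) :
  {in perm_prefix delta j, eta =1 eta'} -> lift_min eta j = lift_min eta' j.
Proof.
move=> eq_eta.
have eqv S : lift_feasible j S -> lift_value eta j S = lift_value eta' j S.
  case/and3P=> /subsetP sS _ _; congr (_ - _); apply: eq_bigr => i.
  rewrite !inE => /andP[ij /sS /imsetP[l]]; rewrite inE ltnS => lj il.
  apply: eq_eta; apply/imsetP; exists l => //; rewrite inE ltn_neqAle lj andbT.
  by apply: contraNneq ij => lj'; rewrite il (val_inj lj').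
have [[S fS e1] min1] := lift_minP eta j.
have [[S' fS' e2] min2] := lift_minP eta' j.
by apply/le_anti/andP; split; [rewrite e2 -eqv // min1 | rewrite e1 eqv // min2].
Qed.

Lemma foldl_lift_step (eta : 'I_n -> R) (s : seq 'I_n) (l : 'I_n) :
  l \notin s -> foldl lift_step eta s (delta l) = eta (delta l).
Proof.
elim: s eta => //= j s IHs eta; rewrite inE negb_or => /andP[lj ls].
by rewrite IHs // /lift_step (inj_eq perm_inj) (negbTE lj).
Qed.

Lemma lifting_coeffE (j : 'I_n) :
  lifting_coeff (delta j) = lift_min lifting_coeff j.
Proof.
have : sorted ltn (map val (enum 'I_n)) by rewrite val_enum_ord iota_ltn_sorted.
have : j \in enum 'I_n by rewrite mem_enum.
rewrite /lifting_coeff => /path.splitPr[s1 s2].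
rewrite (sorted_pairwise ltn_trans) pairwise_map pairwise_cat /=.
case/and4P=> _ _ /allP js2 _.
have notin_s2 (l : 'I_n) : (l <= j)%N -> l \notin s2.
  by move=> lj; apply/negP => /js2 /=; rewrite ltnNge lj.
rewrite foldl_cat /= foldl_lift_step ?notin_s2 // {1}/lift_step eqxx.
apply: eq_lift_min => _ /imsetP[l + ->]; rewrite inE => lj.
rewrite [RHS]foldl_lift_step ?notin_s2 1?ltnW // /lift_step (inj_eq perm_inj).
by case: eqP lj => // ->; rewrite ltnn.
Qed.

Lemma lifting_coeffP (j : 'I_n) :
  (exists2 S, lift_feasible j S &
     lifting_coeff (delta j) = lift_value lifting_coeff j S) /\
  (forall S, lift_feasible j S ->
     lifting_coeff (delta j) <= lift_value lifting_coeff j S).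
Proof. by rewrite lifting_coeffE; exact: lift_minP. Qed.

End Lifting.

(* Main.v *)
Require Import Defs.
From mathcomp Require Import all_boot all_order perm ssralg ssrnum.
From mathcomp Require Import reals.
From mathcomp Require Import interval_inference convex ring lra.

(** If [T] meets every block at most once, minimality in the lifting problem of
    the last element of [T] gives [\sum_(i in T) eta i <= f (a(T))].  Hence, for
    a minimiser [S] of the lifting problem of [delta j], the coefficient is at
    least [f (a(S)) - f (a(S \ delta j))], and since [S \ delta j] is contained
    in the first [j] elements, decreasing increments of the concave [f] finish
    the proof. *)

Import Order.TTheory GRing.Theory Num.Theory.
Local Open Scope ring_scope.

Lemma concave_decreasing_increments (R : realType) (f : R -> R) (x y d : R) :
  concave_function f -> x <= y -> 0 <= d ->
  f (y + d) - f y <= f (x + d) - f x.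
Proof.
move=> f_concave le_xy d_ge0.
(* If [y + d = x], then [x = y] and the claim is trivial; otherwise the weight [p] has a nonzero
   denominator. *)
have [L0|L0] := eqVneq (y + d - x) 0.
  by have -> : x = y by lra.
have L_gt0 : 0 < y + d - x by rewrite lt_neqAle eq_sym L0 /=; lra.
pose p := d / (y + d - x).
have p_ge0 : 0 <= p by rewrite divr_ge0 // ltW.
have p_le1 : p <= 1 by rewrite ler_pdivrMr //; lra.
have f_conv u v : p * f u + (1 - p) * f v <= f (p * u + (1 - p) * v).
  by have := f_concave (Itv01 p_ge0 p_le1) u v; rewrite !convRE.
(* [y] and [x + d] are the convex combinations of [x] and [y + d] with swapped
   weights; adding the two concavity inequalities gives the claim. *)
have := f_conv x (y + d); have := f_conv (y + d) x.
have -> : p * x + (1 - p) * (y + d) = y by rewrite /p; field.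
have -> : p * (y + d) + (1 - p) * x = x + d by rewrite /p; field.
lra.
Qed.

Lemma weight_le (R : realType) (n : nat) (a : 'I_n -> R) (A B : {set 'I_n}) :
  (forall i, 0 <= a i) -> A \subset B -> weight a A <= weight a B.
Proof.
move=> a_ge0 sAB; rewrite /weight [leRHS](big_setID A) /= (setIidPr sAB).
by rewrite lerDl sumr_ge0.
Qed.

Lemma mem_perm_prefix (n : nat) (delta : 'S_n) (j : nat) (i : 'I_n) :
  (delta i \in perm_prefix delta j) = (i < j)%N.
Proof. by rewrite mem_imset ?inE //; exact: perm_inj. Qed.

Lemma perm_prefixS (n : nat) (delta : 'S_n) (j : 'I_n) :
  perm_prefix delta j.+1 = delta j |: perm_prefix delta j.
Proof.
apply/setP => i; rewrite -(permKV delta i) !inE !mem_perm_prefix.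
by rewrite (inj_eq perm_inj) ltnS leq_eqVlt.
Qed.

Lemma sum_lifting_coeff_le (R : realType) (n t : nat) (f : R -> R)
    (a : 'I_n -> R) (N : 'I_t -> {set 'I_n}) (delta : 'S_n) (T : {set 'I_n}) :
  0 <= f 0 -> (forall k, #|T :&: N k| <= 1)%N ->
  \sum_(i in T) lifting_coeff f a N delta i <= f (weight a T).
Proof.
move=> f0 T_indep; have [->|[i0 i0T]] := set_0Vmem T.
  by rewrite /weight !big_set0.
have i0P : delta (delta^-1%g i0) \in T by rewrite permKV.
(* [delta l] is the element of [T] that comes last in the order of [delta], so [T] lies in the
   prefix ending there. *)
have [l lT l_max] :=
  @arg_maxnP _ _ (fun l : 'I_n => delta l \in T) (fun l => l : nat) i0P.
have feas : lift_feasible N delta l T.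
  apply/and3P; split=> //; last by apply/forallP.
  apply/subsetP => i iT; rewrite -(permKV delta i) mem_perm_prefix ltnS.
  by apply: l_max; rewrite /= permKV.
have [_ /(_ T feas)] := lifting_coeffP f a N delta l.
by rewrite /lift_value lerBrDr -big_setD1.
Qed.

Theorem theorem3p11 (R : realType) (n t : nat) (f : R -> R) (a : 'I_n -> R)
    (N : 'I_t -> {set 'I_n}) (n_gt0 : (0 < n)%N) (t_gt0 : (0 < t)%N)
    (f_concave : concave_function f) (f0 : f 0 = 0)
    (a_ge0 : forall i : 'I_n, 0 <= a i)
    (N_partition : consecutive_partition N)
    (a_ascending : ascending_in_blocks N a) :
  forall (delta : 'S_n) (j : 'I_n),
    lifting_coeff f a N delta (delta j) >=
      f (weight a (perm_prefix delta j.+1)) - f (weight a (perm_prefix delta j)).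
Proof.
move=> delta j.
have [[S /and3P[S_prefix /forallP S_indep jS] ->] _] :=
  lifting_coeffP f a N delta j.
rewrite /lift_value; set T := S :\ delta j.
have sum_T : \sum_(i in T) lifting_coeff f a N delta i <= f (weight a T).
  apply: sum_lifting_coeff_le => [|k]; first by rewrite f0.
  apply: leq_trans (S_indep k); apply: subset_leq_card.
  by rewrite setSI // subsetDl.
have T_prefix : T \subset perm_prefix delta j.
  by rewrite subDset -perm_prefixS.
have -> : weight a S = weight a T + a (delta j).
  by rewrite /weight (big_setD1 (delta j)) // addrC.
have -> : weight a (perm_prefix delta j.+1) =
    weight a (perm_prefix delta j) + a (delta j).
  by rewrite /weight perm_prefixS big_setU1 ?mem_perm_prefix ?ltnn // addrC.
(* Adding [a (delta j)] raises [f] at least as much from [weight a T] as from the larger weight of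
   the prefix. *)
have := concave_decreasing_increments R f _ _ _ f_concave
  (weight_le R n a _ _ a_ge0 T_prefix) (a_ge0 (delta j)).
(* After cancelling [f (weight a T + a (delta j))], exactly [sum_T] remains. *)
by move=> /le_trans; apply; rewrite lerD2l lerN2.
Qed.
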